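(* An $m\times n$ net $P_{ij}$ in $\mathbb{R}^d$ satisfies the condition ''each pair of faces with a common edge has equal opposite ratios with respect to that edge'' if and only if it has a Christoffel dual $P_{ij}^*$ with the same areas of corresponding faces. For such an $m\times n$ net, a family of area-preserving Combescure transformations is given, for sufficiently small $\varepsilon>0$, by $$P_{ij}(t)=P_{ij}\cosh t+P_{ij}^*\sinh t,\qquad t\in[0,\varepsilon],\quad 0\le i\le m,\ 0\le j\le n.$$
   Context: An $m\times n$ net is a collection of $(m+1)(n+1)$ points $P_{ij}\in\mathbb{R}^d$, $0\le i\le m$, $0\le j\le n$ (not necessarily distinct), such that for all $0\le i<m$, $0\le j<n$ the points $P_{ij},P_{i+1,j},P_{i+1,j+1},P_{i,j+1}$ are consecutive vertices of a convex (planar, non-degenerate) quadrilateral. These quadrilaterals are the faces and their sides are the edges; they are labeled by the indices of their vertices, and a common edge of two faces must have common labels with both. Faces or edges of two nets spanned by points with the same indices are called corresponding. Points of $\mathbb{R}^d$ are identified with vectors. Two $m\times n$ nets are Combescure transformations of each other (parallel) if their corresponding edges are parallel; a Combescure transformation is area-preserving if corresponding faces have the same areas. Two quadrilaterals $ABCD$ and $A^*B^*C^*D^*$ are dual if corresponding sides are parallel and non-corresponding diagonals are parallel: $AC\parallel B^*D^*$ and $BD\parallel A^*C^*$. Two $m\times n$ nets are Christoffel duals of each other if their corresponding faces are dual. For a convex quadrilateral $ABCD$ with diagonals meeting at $Q$, the opposite ratio of $ABCD$ with respect to the side $AB$ is $\mathrm{Area}(AQB)/\mathrm{Area}(CQD)$.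 *)

(* Defs.v *)
From mathcomp Require Import all_boot all_order all_algebra.
From mathcomp Require Import all_classical all_reals all_analysis.

Set Implicit Arguments.
Unset Strict Implicit.
Unset Printing Implicit Defensive.

Import Order.TTheory GRing.Theory Num.Theory.

Local Open Scope classical_set_scope.
Local Open Scope ring_scope.

Definition cosh (R : realType) (t : R) : R := (expR t + expR (- t)) / 2.
Definition sinh (R : realType) (t : R) : R := (expR t - expR (- t)) / 2.

Definition dot (R : realType) (d : nat) (u v : 'rV[R]_d) : R :=
  \sum_(k < d) u 0 k * v 0 k.

(* The radicand is the Gram determinant of [B - A] and [C - A], which is the
   squared area of the parallelogram they span. *)
Definition triangle_area (R : realType) (d : nat) (A B C : 'rV[R]_d) : R :=
  Num.sqrt (dot (B - A) (B - A) * dot (C - A) (C - A)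
            - dot (B - A) (C - A) ^+ 2) / 2.

(* The lines [AB] and [A'B'] have the same direction (they may coincide);
   only used when [A != B] and [A' != B']. *)
Definition parallel (R : realType) (d : nat) (A B A' B' : 'rV[R]_d) : Prop :=
  exists2 k : R, k != 0 & B' - A' = k *: (B - A).

Definition on_segment (R : realType) (d : nat) (A B Q : 'rV[R]_d) : Prop :=
  exists2 s : R, 0 <= s <= 1 & Q = A + s *: (B - A).

(* [C] is not on the line [AB], and [D] belongs to the open half-plane of the
   plane [ABC] that is bounded by [AB] and contains [C]. *)
Definition same_side (R : realType) (d : nat) (A B C D : 'rV[R]_d) : Prop :=
  free [:: B - A; C - A] /\
  exists r s : R, 0 < s /\ D = A + r *: (B - A) + s *: (C - A).

(* Four points, read as the consecutive vertices of a quadrilateral. *)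
Record quad (R : realType) (d : nat) : Type :=
  Quad { qA : 'rV[R]_d; qB : 'rV[R]_d; qC : 'rV[R]_d; qD : 'rV[R]_d }.

(* Planar, non-degenerate, and lying on one side of each of its side lines. *)
Definition convex_quad (R : realType) (d : nat) (q : quad R d) : Prop :=
  let: Quad A B C D := q in
  [/\ same_side A B C D, same_side B C D A,
      same_side C D A B & same_side D A B C].

Definition quad_area (R : realType) (d : nat) (q : quad R d) : R :=
  let: Quad A B C D := q in triangle_area A B C + triangle_area C D A.

(* For a convex quadrilateral [ABCD] this point exists and is unique; the
   default value [A] is irrelevant. *)
Definition diagonals_meet (R : realType) (d : nat) (A B C D : 'rV[R]_d) :
    'rV[R]_d :=
  xget A [set Q | on_segment A C Q /\ on_segment B D Q].

(* Opposite ratio of [ABCD] with respect to its first side [AB]; the other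
   sides are obtained by cyclically permuting the vertices. *)
Definition opposite_ratio (R : realType) (d : nat) (A B C D : 'rV[R]_d) : R :=
  let Q := diagonals_meet A B C D in
  triangle_area A Q B / triangle_area C Q D.

Definition parallel_sides (R : realType) (d : nat) (q q' : quad R d) : Prop :=
  let: Quad A B C D := q in
  let: Quad A' B' C' D' := q' in
  [/\ parallel A B A' B', parallel B C B' C',
      parallel C D C' D' & parallel D A D' A'].

Definition dual_quads (R : realType) (d : nat) (q q' : quad R d) : Prop :=
  [/\ parallel_sides q q',
      parallel (qA q) (qC q) (qB q') (qD q') &
      parallel (qB q) (qD q) (qA q') (qC q')].

Definition points (R : realType) (m n d : nat) : Type :=
  'I_m.+1 -> 'I_n.+1 -> 'rV[R]_d.

(* Only used for [i < m] and [j < n], where [inord] is faithful. *)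
Definition face (R : realType) (m n d : nat) (P : points R m n d)
    (i j : nat) : quad R d :=
  Quad (P (inord i) (inord j)) (P (inord i.+1) (inord j))
       (P (inord i.+1) (inord j.+1)) (P (inord i) (inord j.+1)).

Definition is_net (R : realType) (m n d : nat) (P : points R m n d) : Prop :=
  forall i j : nat, (i < m)%N -> (j < n)%N -> convex_quad (face P i j).

(* The edges of a net are the sides of its faces. *)
Definition combescure (R : realType) (m n d : nat) (P P' : points R m n d) :
    Prop :=
  [/\ is_net P, is_net P' &
      forall i j : nat, (i < m)%N -> (j < n)%N ->
        parallel_sides (face P i j) (face P' i j)].

Definition same_face_areas (R : realType) (m n d : nat)
    (P P' : points R m n d) : Prop :=
  forall i j : nat, (i < m)%N -> (j < n)%N ->
    quad_area (face P i j) = quad_area (face P' i j).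

Definition area_preserving_combescure (R : realType) (m n d : nat)
    (P P' : points R m n d) : Prop :=
  combescure P P' /\ same_face_areas P P'.

Definition christoffel_dual (R : realType) (m n d : nat)
    (P P' : points R m n d) : Prop :=
  [/\ is_net P, is_net P' &
      forall i j : nat, (i < m)%N -> (j < n)%N ->
        dual_quads (face P i j) (face P' i j)].

(* Side [BC] of face (i, j) is side [DA] of face (i+1, j), and side [CD] of
   face (i, j) is side [AB] of face (i, j+1). *)
Definition equal_opposite_ratios (R : realType) (m n d : nat)
    (P : points R m n d) : Prop :=
  (forall i j : nat, (i.+1 < m)%N -> (j < n)%N ->
     let: Quad A B C D := face P i j in
     let: Quad A' B' C' D' := face P i.+1 j in
     opposite_ratio B C D A = opposite_ratio D' A' B' C') /\
  (forall i j : nat, (i < m)%N -> (j.+1 < n)%N ->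
     let: Quad A B C D := face P i j in
     let: Quad A' B' C' D' := face P i j.+1 in
     opposite_ratio C D A B = opposite_ratio A' B' C' D').

Definition hyperbolic_family (R : realType) (m n d : nat)
    (P P' : points R m n d) (t : R) : points R m n d :=
  fun i j => cosh t *: P i j + sinh t *: P' i j.

(* Main.v *)
(* Let Q be the intersection of the diagonals of a convex face and write
   A = Q - a u, B = Q - b v, C = Q + c u, D = Q + e v with a, b, c, e > 0.
   Matching parallel sides and crossed diagonals forces the edge vectors of a
   dual face to be those of ABCD times -mu/(ab), mu/(bc), -mu/(ce), mu/(ea)
   for some mu, and the areas agree iff mu^2 = abce.  The opposite ratio with
   respect to AB is ab/(ce), so each edge of an equiareal dual is the original
   one divided by the square root of its opposite ratio, up to a sign that
   alternates around the face.  Hence the duals of two adjacent faces fit along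
   their common edge iff the two ratios there agree, and then the edges close up
   around every face and integrate to a dual net.
   In the family P cosh t + P* sinh t each edge is scaled by
   cosh t + k sinh t, positive for small t, and the area of a face is multiplied
   by cosh^2 t - (mu^2 / abce) sinh^2 t = 1. *)
Require Import Defs.
From mathcomp Require Import all_boot all_order all_algebra.
From mathcomp Require Import all_classical all_reals all_analysis.
From mathcomp Require Import ring lra.

Set Implicit Arguments.
Unset Strict Implicit.

Import Order.TTheory GRing.Theory Num.Theory.
Local Open Scope ring_scope.

(** * Coordinates, areas and convexity with respect to two independent vectors *)

Section Plane.
Context {R : realType} {d : nat}.
Implicit Types (u v : 'rV[R]_d) (A B C D Q : 'rV[R]_d).

Lemma free_pairP u v :
  reflect (forall x y : R, x *: u + y *: v = 0 -> x = 0 /\ y = 0)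
          (free [:: u; v]).
Proof.
apply: (iffP (@freeP _ _ _ [tuple u; v])) => [uv x y xy0|uv k].
  have := uv (fun i : 'I_2 => if i == 0 then x else y).
  rewrite !big_ord_recl big_ord0 addr0 /= => /(_ xy0) k0.
  by split; [have := k0 ord0 | have := k0 (lift ord0 ord0)].
rewrite !big_ord_recl big_ord0 addr0 /= => /uv[k0 k1] i.
case: i => [[|[|//]] lti]; first by rewrite -k0; congr k; apply: val_inj.
by rewrite -k1; congr k; apply: val_inj.
Qed.

Lemma eq_coord u v (x y x' y' : R) : free [:: u; v] ->
  x *: u + y *: v = x' *: u + y' *: v -> x = x' /\ y = y'.
Proof.
move=> /free_pairP uv e.
have /uv[/subr0_eq-> /subr0_eq->] : (x - x') *: u + (y - y') *: v = 0.
  by rewrite !scalerBl addrACA e -opprD subrr.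
by [].
Qed.

Lemma free_swap u v : free [:: u; v] -> free [:: v; u].
Proof.
by move=> /free_pairP uv; apply/free_pairP => x y; rewrite addrC => /uv[].
Qed.

Lemma free_neq0 u v : free [:: u; v] -> u != 0.
Proof.
move=> /free_pairP uv; apply/eqP => u0.
have [|/eqP] := uv 1 0; last by rewrite oner_eq0.
by rewrite u0 scaler0 scale0r addr0.
Qed.

Lemma dotDl u u' v : dot (u + u') v = dot u v + dot u' v.
Proof.
by rewrite /dot -big_split; apply: eq_bigr => k _; rewrite mxE mulrDl.
Qed.

Lemma dotZl (x : R) u v : dot (x *: u) v = x * dot u v.
Proof. by rewrite /dot mulr_sumr; apply: eq_bigr => k _; rewrite mxE mulrA. Qed.

Lemma dotC u v : dot u v = dot v u.
Proof. by apply: eq_bigr => k _; rewrite mulrC. Qed.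

Lemma dotDr u v v' : dot u (v + v') = dot u v + dot u v'.
Proof. by rewrite ![dot u _]dotC dotDl. Qed.

Lemma dotZr (x : R) u v : dot u (x *: v) = x * dot u v.
Proof. by rewrite ![dot u _]dotC dotZl. Qed.

Lemma dot_gt0 u : u != 0 -> 0 < dot u u.
Proof.
have sq_ge0 (k : 'I_d) : true -> 0 <= u 0 k * u 0 k by rewrite -expr2 sqr_ge0.
rewrite lt_neqAle sumr_ge0 // andbT; apply: contra.
move=> /eqP/esym/(psumr_eq0P sq_ge0) u0.
apply/eqP/rowP => k; rewrite mxE; apply/eqP.
by rewrite -[_ == 0]orbb -mulf_eq0 u0.
Qed.

Lemma dot_subC u v : dot (u - v) (u - v) = dot (v - u) (v - u).
Proof. by apply: eq_bigr => k _; rewrite !mxE; ring. Qed.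

Definition gram u v : R := dot u u * dot v v - dot u v ^+ 2.

(** Strict Cauchy-Schwarz: [w] is [dot v v] times the component of [u] orthogonal to [v], and
    [dot w w = dot v v * gram u v]. *)
Lemma gram_gt0 u v : free [:: u; v] -> 0 < gram u v.
Proof.
move=> uv; have v0 := free_neq0 (free_swap uv); move: uv => /free_pairP uv.
have vv := dot_gt0 v0.
set w := dot v v *: u - dot u v *: v.
have w0 : w != 0.
  by apply/eqP; rewrite /w -scaleNr => /uv[vv0 _]; move: vv; rewrite vv0 ltxx.
have eww : dot w w = dot v v * gram u v.
  rewrite /w -scaleNr !(dotDl, dotDr, dotZl, dotZr) [dot v u]dotC /gram.
  by ring.
by have := dot_gt0 w0; rewrite eww pmulr_rgt0.
Qed.

Lemma triangle_area_coord u v A B C (x y x' y' : R) :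
  B - A = x *: u + y *: v -> C - A = x' *: u + y' *: v ->
  triangle_area A B C = `|x * y' - y * x'| * (Num.sqrt (gram u v) / 2).
Proof.
move=> eB eC; rewrite /triangle_area eB eC mulrA; congr (_ / 2).
rewrite -sqrtr_sqr -sqrtrM ?sqr_ge0 //; congr Num.sqrt.
rewrite !(dotDl, dotDr, dotZl, dotZr) [dot v u]dotC /gram; ring.
Qed.

(** The two positive determinants say that the path turns the same way at [B] and at [A], the ends
    of the side [AB]. Cramer's rule then gives the coordinates of [D], the second being the quotient
    of these determinants. *)
Lemma same_side_coord u v A B C D (x y x' y' x'' y'' : R) : free [:: u; v] ->
  B - A = x *: u + y *: v -> C - B = x' *: u + y' *: v ->
  A - D = x'' *: u + y'' *: v ->
  0 < x * y' - y * x' -> 0 < x'' * y - y'' * x -> same_side A B C D.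
Proof.
move=> uv eB eC eD p q.
have eCA : C - A = (x + x') *: u + (y + y') *: v.
  by rewrite -[C](subrK B) -addrA eB eC; apply/rowP => k; rewrite !mxE; ring.
have z : x * y' - y * x' != 0 by rewrite gt_eqF.
split.
  apply/free_pairP => r s; rewrite eB eCA => h.
  have [|h1 h2] := @eq_coord u v (r * x + s * (x + x'))
    (r * y + s * (y + y')) 0 0 uv.
    rewrite !scale0r addr0 -h; apply/rowP => k; rewrite !mxE; ring.
  split; apply: (mulIf z); rewrite mul0r.
    transitivity ((y + y') * (r * x + s * (x + x')) -
                  (x + x') * (r * y + s * (y + y'))); first by ring.
    by rewrite h1 h2 !mulr0 subr0.
  transitivity (x * (r * y + s * (y + y')) - y * (r * x + s * (x + x'))).
    by ring.
  by rewrite h1 h2 !mulr0 subr0.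
exists (- ((x'' * (y + y') - y'' * (x + x')) / (x * y' - y * x'))),
  ((x'' * y - y'' * x) / (x * y' - y * x')).
split; first by rewrite divr_gt0.
apply: (addrI (- A)); rewrite eB eCA -[D](subrK A) -opprB eD.
by apply/rowP => k; rewrite !mxE; field.
Qed.

Lemma convex_quad_coord u v A B C D (x1 y1 x2 y2 x3 y3 x4 y4 : R) :
  free [:: u; v] ->
  B - A = x1 *: u + y1 *: v -> C - B = x2 *: u + y2 *: v ->
  D - C = x3 *: u + y3 *: v -> A - D = x4 *: u + y4 *: v ->
  0 < x1 * y2 - y1 * x2 -> 0 < x2 * y3 - y2 * x3 ->
  0 < x3 * y4 - y3 * x4 -> 0 < x4 * y1 - y4 * x1 ->
  convex_quad (Quad A B C D).
Proof.
move=> uv e1 e2 e3 e4 p1 p2 p3 p4; split.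
- exact: same_side_coord uv e1 e2 e4 p1 p4.
- exact: same_side_coord uv e2 e3 e1 p2 p1.
- exact: same_side_coord uv e3 e4 e2 p3 p2.
- exact: same_side_coord uv e4 e1 e3 p4 p3.
Qed.

Lemma quad_area_coord u v A B C D (x1 y1 x2 y2 x3 y3 x4 y4 : R) :
  B - A = x1 *: u + y1 *: v -> C - B = x2 *: u + y2 *: v ->
  D - C = x3 *: u + y3 *: v -> A - D = x4 *: u + y4 *: v ->
  quad_area (Quad A B C D) =
  (`|x1 * y2 - y1 * x2| + `|x3 * y4 - y3 * x4|) * (Num.sqrt (gram u v) / 2).
Proof.
move=> e1 e2 e3 e4 /=.
have chord X Y Z (x y x' y' : R) : Y - X = x *: u + y *: v ->
    Z - Y = x' *: u + y' *: v -> Z - X = (x + x') *: u + (y + y') *: v.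
  move=> e e'; rewrite -[Z](subrK Y) -addrA e e'.
  by apply/rowP => k; rewrite !mxE; ring.
rewrite (triangle_area_coord e1 (chord _ _ _ _ _ _ _ e1 e2)).
rewrite (triangle_area_coord e3 (chord _ _ _ _ _ _ _ e3 e4)) -mulrDl.
by congr ((_ + _) * _); congr `|_|; ring.
Qed.

(** * Convex quadrilaterals described by their diagonals *)

Definition diag_quad Q u v (a b c e : R) : quad R d :=
  Quad (Q - a *: u) (Q - b *: v) (Q + c *: u) (Q + e *: v).

Lemma convex_diag_quad Q u v (a b c e : R) : free [:: u; v] ->
  0 < a -> 0 < b -> 0 < c -> 0 < e -> convex_quad (diag_quad Q u v a b c e).
Proof.
move=> uv a0 b0 c0 e0.
apply: (convex_quad_coord (x1 := a) (y1 := - b) (x2 := c) (y2 := b)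
  (x3 := - c) (y3 := e) (x4 := - a) (y4 := - e) uv);
  try by apply/rowP => k; rewrite !mxE; ring.
all: by nra.
Qed.

Lemma convex_quad_diag (q : quad R d) : convex_quad q ->
  exists Q u v (a b c e : R),
    [/\ free [:: u; v], [/\ 0 < a, 0 < b, 0 < c & 0 < e] &
        q = diag_quad Q u v a b c e].
Proof.
case: q => A B C D [[uv [r [s [s0 eD]]]] [_ [r2 [s2 [s20 e2]]]]
  [_ [r3 [s3 [s30 e3]]]] _].
move: (uv); set u := B - A; set v := C - A => uv'.
have eB : B = A + u by rewrite addrC subrK.
have eC : C = A + v by rewrite addrC subrK.
rewrite -/u -/v in eD.
have [|h1 h2] := @eq_coord u v (- 1) 0
   (- r2 + s2 * (r - 1)) (r2 + s2 * s) uv'.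
  apply: (addIr B); rewrite {1}eB.
  transitivity A; first by apply/rowP => k; rewrite !mxE; ring.
  by rewrite [LHS]e2 eD eB eC; apply/rowP => k; rewrite !mxE; ring.
have [|h3 h4] := @eq_coord u v 1 (- 1)
   (r3 * r) (r3 * (s - 1) - s3) uv'.
  apply: (addIr C); rewrite {1}eC.
  transitivity B; first by rewrite eB; apply/rowP => k; rewrite !mxE; ring.
  by rewrite [LHS]e3 eD eC; apply/rowP => k; rewrite !mxE; ring.
(* That [A] and [D] lie on one side of [BC] gives [r + s < 1]; then that [A] and [B] lie on one side
   of [CD] gives [r < 0]. *)
have rs : r + s < 1 by nra.
have r0 : r < 0 by nra.
have r1 : 1 - r != 0 by lra.
(* The new directions are the diagonals [C - A] and [D - B] themselves. Solving for their
   intersection, it divides [AC] at parameter [s / (1 - r)] and [BD] at [1 / (1 - r)]; the two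
   inequalities put both parameters strictly below 1. *)
exists (A + (s / (1 - r)) *: v), v, (D - B), (s / (1 - r)), (1 / (1 - r)),
  (1 - s / (1 - r)), (1 - 1 / (1 - r)); split.
- apply/free_pairP => x y; rewrite eD eB => h.
  have [|k1 k2] := @eq_coord u v (y * (r - 1)) (x + y * s) 0 0 uv'.
    rewrite !scale0r addr0 -h; apply/rowP => k; rewrite !mxE; ring.
  have y0 : y = 0 by nra.
  by move: k2; rewrite y0 mul0r addr0.
- have r1' : 0 < 1 - r by lra.
  by split; rewrite ?subr_gt0 ?ltr_pdivrMr ?divr_gt0 //; lra.
by rewrite /diag_quad eD eB eC; congr Quad; apply/rowP => k;
  rewrite !mxE; field.
Qed.

(** Cyclic relabelling replaces [(u, v)] by [(v, - u)], so a fact proved for the first side passes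
    to the other three. *)
Lemma diag_quad_rot Q u v (a b c e : R) A B C D :
  Quad A B C D = diag_quad Q u v a b c e ->
  Quad B C D A = diag_quad Q v (- u) b c e a.
Proof. by move=> [-> -> -> ->]; rewrite /diag_quad !scalerN opprK. Qed.

Lemma diagonals_meet_diag Q u v (a b c e : R) : free [:: u; v] ->
  0 < a -> 0 < b -> 0 < c -> 0 < e ->
  diagonals_meet (Q - a *: u) (Q - b *: v) (Q + c *: u) (Q + e *: v) = Q.
Proof.
move=> uv a0 b0 c0 e0; rewrite /diagonals_meet; case: xgetP => /=.
  move=> X _ [[s _ eX] [t _ eX']].
  have [|h1 h2] := @eq_coord u v (- a + s * (c + a)) 0 0 (- b + t * (e + b)) uv.
    apply: (addrI Q); transitivity X.
      by rewrite eX; apply/rowP => k; rewrite !mxE; ring.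
    by rewrite eX'; apply/rowP => k; rewrite !mxE; ring.
  transitivity (Q + (- a + s * (c + a)) *: u); last by rewrite h1 scale0r addr0.
  by rewrite eX; apply/rowP => k; rewrite !mxE; ring.
(* The default value of [xget] is excluded because [Q] itself lies on both diagonals. *)
move=> /(_ Q) []; split.
  exists (a / (a + c)).
    by rewrite divr_ge0 ?ler_pdivrMr; lra.
  by apply/rowP => k; rewrite !mxE; field; lra.
exists (b / (b + e)).
  by rewrite divr_ge0 ?ler_pdivrMr; lra.
by apply/rowP => k; rewrite !mxE; field; lra.
Qed.

Lemma opposite_ratio_diag Q u v (a b c e : R) : free [:: u; v] ->
  0 < a -> 0 < b -> 0 < c -> 0 < e ->
  opposite_ratio (Q - a *: u) (Q - b *: v) (Q + c *: u) (Q + e *: v) =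
  a * b / (c * e).
Proof.
move=> uv a0 b0 c0 e0; rewrite /opposite_ratio diagonals_meet_diag //.
rewrite (triangle_area_coord (u := u) (v := v)
  (x := a) (y := 0) (x' := a) (y' := - b));
  try by apply/rowP => k; rewrite !mxE; ring.
rewrite (triangle_area_coord (u := u) (v := v)
  (x := - c) (y := 0) (x' := - c) (y' := e));
  try by apply/rowP => k; rewrite !mxE; ring.
have g0 : 0 < Num.sqrt (gram u v) by rewrite sqrtr_gt0 gram_gt0.
rewrite !mul0r !subr0 mulrN mulNr !normrN !gtr0_norm ?mulr_gt0 //.
by field; rewrite !gt_eqF.
Qed.


(** * Edges and areas of dual quadrilaterals *)

(* The edges of a dual of [diag_quad Q u v a b c e]; its diagonals meet at a
   point [Q'] with [A' = Q' - (mu / a) *: v], [B' = Q' - (mu / b) *: u],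
   [C' = Q' + (mu / c) *: v] and [D' = Q' + (mu / e) *: u]. *)
Definition dual_edges u v (a b c e mu : R) (q : quad R d) : Prop :=
  let: Quad A B C D := q in
  [/\ B - A = (- (mu / b)) *: u + (mu / a) *: v,
      C - B = (mu / b) *: u + (mu / c) *: v,
      D - C = (mu / e) *: u + (- (mu / c)) *: v &
      A - D = (- (mu / e)) *: u + (- (mu / a)) *: v].

Lemma dual_quads_edges Q u v (a b c e : R) (q : quad R d) : free [:: u; v] ->
  0 < a -> 0 < b -> 0 < c -> 0 < e ->
  dual_quads (diag_quad Q u v a b c e) q ->
  exists mu, dual_edges u v a b c e mu q.
Proof.
case: q => A B C D uv a0 b0 c0 e0.
case=> -[[k1 _ e1] [k2 _ e2] [k3 _ e3] [k4 _ e4]] [l1 _ /= f1] [l2 _ /= f2].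
(* The diagonal [D - B] of the dual has no [v]-component and [C - A] no [u]-component. Writing each
   as a sum of two consecutive sides gives three linear relations among the factors [k1], ..., [k4],
   which leave one free parameter. *)
have [|_ g1] := @eq_coord u v (k2 * c - k3 * c) (k2 * b + k3 * e)
   (l1 * (c + a)) 0 uv.
  transitivity ((C - B) + (D - C)).
    by rewrite e2 e3; apply/rowP => k; rewrite !mxE; ring.
  transitivity (D - B); first by apply/rowP => k; rewrite !mxE; ring.
  by rewrite f1; apply/rowP => k; rewrite !mxE; ring.
have [|g2 _] := @eq_coord u v (k1 * a + k2 * c) (- (k1 * b) + k2 * b)
   0 (l2 * (e + b)) uv.
  transitivity ((B - A) + (C - B)).
    by rewrite e1 e2; apply/rowP => k; rewrite !mxE; ring.
  transitivity (C - A); first by apply/rowP => k; rewrite !mxE; ring.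
  by rewrite f2; apply/rowP => k; rewrite !mxE; ring.
have [|g3 _] := @eq_coord u v (- (k3 * c) - k4 * a) (k3 * e - k4 * e)
   0 (- (l2 * (e + b))) uv.
  transitivity ((D - C) + (A - D)).
    by rewrite e3 e4; apply/rowP => k; rewrite !mxE; ring.
  transitivity (- (C - A)); first by apply/rowP => k; rewrite !mxE; ring.
  by rewrite f2; apply/rowP => k; rewrite !mxE; ring.
have a1 : a != 0 by rewrite gt_eqF.
have b1 : b != 0 by rewrite gt_eqF.
have c1 : c != 0 by rewrite gt_eqF.
have e1' : e != 0 by rewrite gt_eqF.
have k1E : k1 = - (k2 * c) / a.
  by apply: (mulIf a1); rewrite divfK //; lra.
have k3E : k3 = - (k2 * b) / e.
  by apply: (mulIf e1'); rewrite divfK //; lra.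
have k4E : k4 = k2 * b * c / (e * a).
  apply: (mulIf a1); transitivity (- (k3 * c)); first by lra.
  by rewrite k3E; field; rewrite a1.
exists (k2 * b * c).
by split; rewrite ?e1 ?e2 ?e3 ?e4 ?k1E ?k3E ?k4E; apply/rowP => k; rewrite !mxE;
   field; rewrite ?a1 ?b1 ?c1 ?e1'.
Qed.

(** The sign of [mu] changes because the side factors alternate in sign around the quadrilateral. *)
Lemma dual_edges_rot u v (a b c e mu : R) A B C D :
  dual_edges u v a b c e mu (Quad A B C D) ->
  dual_edges v (- u) b c e a (- mu) (Quad B C D A).
Proof.
by move=> [e1 e2 e3 e4]; split; rewrite ?e1 ?e2 ?e3 ?e4 !mulNr scalerN;
  apply/rowP => k; rewrite !mxE; ring.
Qed.

Lemma quad_area_diag Q u v (a b c e : R) :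
  0 < a -> 0 < b -> 0 < c -> 0 < e ->
  quad_area (diag_quad Q u v a b c e) =
  (a + c) * (b + e) * (Num.sqrt (gram u v) / 2).
Proof.
move=> a0 b0 c0 e0.
rewrite (@quad_area_coord u v _ _ _ _ a (- b) c b (- c) e (- a) (- e));
  try by apply/rowP => k; rewrite !mxE; ring.
by congr (_ * _); rewrite !ger0_norm; first ring; nra.
Qed.

(** This is the area formula for a quadrilateral in diagonal form, with [a], [b], [c], [e] replaced
    by [mu] times their inverses. It is computed from the edges since [mu] may have either sign. *)
Lemma quad_area_dual u v (a b c e mu : R) (q : quad R d) :
  0 < a -> 0 < b -> 0 < c -> 0 < e ->
  dual_edges u v a b c e mu q ->
  quad_area q =
  mu ^+ 2 * (a^-1 + c^-1) * (b^-1 + e^-1) * (Num.sqrt (gram u v) / 2).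
Proof.
case: q => A B C D a0 b0 c0 e0 [e1 e2 e3 e4].
rewrite (quad_area_coord e1 e2 e3 e4); congr (_ * _).
rewrite (_ : _ - _ = - (mu ^+ 2 * (a^-1 + c^-1) * b^-1)); last by ring.
rewrite (_ : mu / e * _ - _ = - (mu ^+ 2 * (a^-1 + c^-1) * e^-1)); last by ring.
move: (mu ^+ 2) (sqr_ge0 mu) => m m0.
rewrite !normrN !ger0_norm; first by ring.
  all: by rewrite !mulr_ge0 ?addr_ge0 ?invr_ge0 // ltW.
Qed.

(** The area of the dual is [mu ^+ 2 / (a * b * c * e)] times that of the original. *)
Lemma dual_same_area Q u v (a b c e mu : R) (q : quad R d) :
  free [:: u; v] -> 0 < a -> 0 < b -> 0 < c -> 0 < e ->
  dual_edges u v a b c e mu q ->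
  quad_area (diag_quad Q u v a b c e) = quad_area q <->
  mu ^+ 2 = a * b * c * e.
Proof.
move=> uv a0 b0 c0 e0 dq.
rewrite (quad_area_dual _ _ _ _ dq) // quad_area_diag //.
have g0 : Num.sqrt (gram u v) / 2 != 0.
  by rewrite gt_eqF // divr_gt0 // sqrtr_gt0 gram_gt0.
have ac : (a + c) * (b + e) != 0 by rewrite gt_eqF // mulr_gt0 // addr_gt0.
have -> : mu ^+ 2 * (a^-1 + c^-1) * (b^-1 + e^-1)
    = (a + c) * (b + e) * (mu ^+ 2 / (a * b * c * e)).
  by field; rewrite !gt_eqF.
have z : a * b * c * e != 0 by rewrite gt_eqF // !mulr_gt0.
split=> [/(mulIf g0)|->]; last by rewrite divff // mulr1.
by rewrite -{1}[_ * (b + e)]mulr1 => /(mulfI ac)/esym/divr1_eq.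
Qed.

(** The side is scaled by [- mu / (a * b)], whose square [c * e / (a * b)] is the inverse opposite
    ratio. Squared lengths make the sign of [mu] irrelevant. *)
Lemma dual_edge_ratio Q u v (a b c e mu : R) A B C D A' B' C' D' :
  free [:: u; v] -> 0 < a -> 0 < b -> 0 < c -> 0 < e ->
  mu ^+ 2 = a * b * c * e ->
  Quad A B C D = diag_quad Q u v a b c e ->
  dual_edges u v a b c e mu (Quad A' B' C' D') ->
  dot (B' - A') (B' - A') * opposite_ratio A B C D = dot (B - A) (B - A).
Proof.
move=> uv a0 b0 c0 e0 mu2 [-> -> -> ->] [-> _ _ _].
rewrite opposite_ratio_diag //.
set w := (X in _ = dot X _).
have -> : (- (mu / b)) *: u + (mu / a) *: v = (- (mu / (a * b))) *: w.
  by apply/rowP => k; rewrite !mxE; field; rewrite !gt_eqF.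
rewrite dotZl dotZr [_ * (_ * dot _ _)]mulrA -expr2 sqrrN expr_div_n mu2.
by field; rewrite !gt_eqF.
Qed.


Lemma free_rot u v : free [:: u; v] -> free [:: v; - u].
Proof.
move=> /free_pairP uv; apply/free_pairP => x y.
by rewrite scalerN -scaleNr addrC => /uv[/eqP]; rewrite oppr_eq0 => /eqP-> ->.
Qed.

Lemma dual_edge_ratios A B C D A' B' C' D' :
  let q := Quad A B C D in let q' := Quad A' B' C' D' in
  convex_quad q -> dual_quads q q' -> quad_area q = quad_area q' ->
  [/\ dot (B' - A') (B' - A') * opposite_ratio A B C D = dot (B - A) (B - A),
      dot (C' - B') (C' - B') * opposite_ratio B C D A = dot (C - B) (C - B),
      dot (D' - C') (D' - C') * opposite_ratio C D A B = dot (D - C) (D - C) &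
      dot (A' - D') (A' - D') * opposite_ratio D A B C = dot (A - D) (A - D)].
Proof.
move=> q q' /convex_quad_diag[Q [u [v [a [b [c [e [uv [a0 b0 c0 e0] qE]]]]]]]].
rewrite qE => /dual_quads_edges-/(_ uv a0 b0 c0 e0)[mu dq].
rewrite (dual_same_area Q uv _ _ _ _ dq) // => mu2.
have uv1 := free_rot uv; have uv2 := free_rot uv1; have uv3 := free_rot uv2.
have qE1 := diag_quad_rot qE.
have qE2 := diag_quad_rot qE1.
have qE3 := diag_quad_rot qE2.
have dq1 := dual_edges_rot dq; have dq2 := dual_edges_rot dq1.
have dq3 := dual_edges_rot dq2.
split.
- exact: dual_edge_ratio uv a0 b0 c0 e0 mu2 qE dq.
- by apply: dual_edge_ratio uv1 b0 c0 e0 a0 _ qE1 dq1; rewrite sqrrN mu2; ring.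
- by apply: dual_edge_ratio uv2 c0 e0 a0 b0 _ qE2 dq2; rewrite !sqrrN mu2; ring.
- by apply: dual_edge_ratio uv3 e0 a0 b0 c0 _ qE3 dq3; rewrite !sqrrN mu2; ring.
Qed.

(** * Construction of an equiareal dual of one face *)

(** The absolute value of the scaling of side [AB] in an equiareal dual. It depends on the opposite
    ratio only, so two faces with equal ratios at a common edge agree on it. *)
Definition dual_factor A B C D : R := (Num.sqrt (opposite_ratio A B C D))^-1.

Lemma dual_factor_diag Q u v (a b c e mu : R) A B C D :
  free [:: u; v] -> 0 < a -> 0 < b -> 0 < c -> 0 < e ->
  0 < mu -> mu ^+ 2 = a * b * c * e ->
  Quad A B C D = diag_quad Q u v a b c e ->
  dual_factor A B C D = mu / (a * b).
Proof.
move=> uv a0 b0 c0 e0 mu0 mu2 [-> -> -> ->].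
rewrite /dual_factor opposite_ratio_diag //.
rewrite (_ : a * b / (c * e) = (a * b / mu) ^+ 2).
  by rewrite sqrtr_sqr ger0_norm ?invf_div // ltW // divr_gt0 // mulr_gt0.
by rewrite expr_div_n mu2; field; rewrite !gt_eqF.
Qed.

Lemma dual_factors_diag A B C D : convex_quad (Quad A B C D) ->
  exists Q u v (a b c e mu : R),
    [/\ free [:: u; v],
        [/\ 0 < a, 0 < b, 0 < c & 0 < e],
        0 < mu /\ mu ^+ 2 = a * b * c * e,
        Quad A B C D = diag_quad Q u v a b c e &
        [/\ dual_factor A B C D = mu / (a * b),
            dual_factor B C D A = mu / (b * c),
            dual_factor C D A B = mu / (c * e) &
            dual_factor D A B C = mu / (e * a)]].
Proof.
move=> /convex_quad_diag[Q [u [v [a [b [c [e [uv [a0 b0 c0 e0] qE]]]]]]]].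
have p0 : 0 < a * b * c * e by rewrite !mulr_gt0.
have mu0 : 0 < Num.sqrt (a * b * c * e) by rewrite sqrtr_gt0.
have mu2 := sqr_sqrtr (ltW p0).
exists Q, u, v, a, b, c, e, (Num.sqrt (a * b * c * e)).
have uv1 := free_rot uv; have uv2 := free_rot uv1; have uv3 := free_rot uv2.
have qE1 := diag_quad_rot qE.
have qE2 := diag_quad_rot qE1.
have qE3 := diag_quad_rot qE2.
split=> //; split.
- exact: dual_factor_diag uv a0 b0 c0 e0 mu0 mu2 qE.
- by apply: dual_factor_diag uv1 b0 c0 e0 a0 mu0 _ qE1; rewrite mu2; ring.
- by apply: dual_factor_diag uv2 c0 e0 a0 b0 mu0 _ qE2; rewrite mu2; ring.
- by apply: dual_factor_diag uv3 e0 a0 b0 c0 mu0 _ qE3; rewrite mu2; ring.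
Qed.

(** Along either path from [A] to [C] the [u]-components cancel, and both sums equal
    [mu * (a^-1 + c^-1) *: v], a diagonal of the dual. *)
Lemma dual_factors_closed A B C D : convex_quad (Quad A B C D) ->
  - dual_factor A B C D *: (B - A) + dual_factor B C D A *: (C - B) =
  dual_factor D A B C *: (D - A) + - dual_factor C D A B *: (C - D).
Proof.
move=> /dual_factors_diag.
move=> [Q [u [v [a [b [c [e [mu [uv [a0 b0 c0 e0] _ qE [-> -> -> ->]]]]]]]]]].
move: qE => [-> -> -> ->].
by apply/rowP => k; rewrite !mxE; field; rewrite !gt_eqF.
Qed.

Lemma dual_quad_of_factors A B C D A' B' C' D' :
  let q := Quad A B C D in let q' := Quad A' B' C' D' in
  convex_quad q ->
  B' - A' = - dual_factor A B C D *: (B - A) ->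
  C' - B' = dual_factor B C D A *: (C - B) ->
  C' - D' = - dual_factor C D A B *: (C - D) ->
  D' - A' = dual_factor D A B C *: (D - A) ->
  [/\ convex_quad q', dual_quads q q' & quad_area q = quad_area q'].
Proof.
move=> q q' /dual_factors_diag.
move=> [Q [u [v [a [b [c [e [mu [uv [a0 b0 c0 e0] [mu0 mu2] qE]]]]]]]]].
move=> [-> -> -> ->].
have nz : [/\ a != 0, b != 0, c != 0, e != 0 & mu != 0] by rewrite !gt_eqF.
case: nz => a1 b1 c1 e1 mu1.
rewrite (qE : q = _); move: qE => [eA eB eC eD].
rewrite eA eB eC eD => h1 h2 h3 h4.
have dq : dual_edges u v a b c e mu q'.
  have h3' := congr1 -%R h3; have h4' := congr1 -%R h4.
  rewrite !opprB in h3' h4'.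
  split; rewrite ?h1 ?h2 ?h3' ?h4'; apply/rowP => k; rewrite !mxE; field;
    by rewrite ?a1 ?b1 ?c1 ?e1.
(* The dual is again in diagonal form, with the two directions exchanged; convexity and the crossed
   parallel diagonals are read off from this. *)
have q'E : q' = diag_quad (A' + (mu / a) *: v) v u
    (mu / a) (mu / b) (mu / c) (mu / e).
  case: dq => k1 k2 k3 k4; congr Quad.
  - by rewrite addrK.
  - rewrite -[LHS](subrK A') k1; apply/rowP => k; rewrite !mxE; ring.
  - rewrite -[LHS](subrK B') -[X in _ + X](subrK A') k1 k2.
    by apply/rowP => k; rewrite !mxE; ring.
  - rewrite -[LHS]opprK -[- D'](addKr A') k4.
    by apply/rowP => k; rewrite !mxE; ring.
split.
- by rewrite q'E; apply: convex_diag_quad (free_swap uv) _ _ _ _;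
    rewrite divr_gt0.
- case: dq => k1 k2 k3 k4; split; first split.
  + exists (- (mu / (a * b))).
      by rewrite oppr_eq0 mulf_neq0 ?invr_neq0 ?mulf_neq0.
    by rewrite k1; apply/rowP => k; rewrite !mxE; field; rewrite a1 b1.
  + exists (mu / (b * c)).
      by rewrite mulf_neq0 ?invr_neq0 ?mulf_neq0.
    by rewrite k2; apply/rowP => k; rewrite !mxE; field; rewrite c1 b1.
  + exists (- (mu / (c * e))).
      by rewrite oppr_eq0 mulf_neq0 ?invr_neq0 ?mulf_neq0.
    by rewrite k3; apply/rowP => k; rewrite !mxE; field; rewrite c1 e1.
  + exists (mu / (e * a)).
      by rewrite mulf_neq0 ?invr_neq0 ?mulf_neq0.
    by rewrite k4; apply/rowP => k; rewrite !mxE; field; rewrite a1 e1.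
  + exists ((mu / e + mu / b) / (c + a)).
      by rewrite gt_eqF // divr_gt0 ?addr_gt0 ?divr_gt0.
    move: q'E => /= [_ -> _ ->]; apply/rowP => k; rewrite !mxE; field.
    by rewrite b1 e1 gt_eqF // addr_gt0.
  + exists ((mu / c + mu / a) / (e + b)).
      by rewrite gt_eqF // divr_gt0 ?addr_gt0 ?divr_gt0.
    move: q'E => /= [eA' _ -> _]; rewrite {2}eA'.
    apply/rowP => k; rewrite !mxE; field.
    by rewrite a1 c1 gt_eqF // addr_gt0.
by apply/(dual_same_area Q uv a0 b0 c0 e0 dq).
Qed.

End Plane.

(** * Hyperbolic functions for small arguments *)

Section Hyperbolic.
Context {R : realType}.

Lemma cosh_sinh_sqr (t : R) : cosh t ^+ 2 - sinh t ^+ 2 = 1.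
Proof.
by transitivity (expR t * expR (- t)); [rewrite /cosh /sinh; field|
  exact: expRxMexpNx_1].
Qed.

Lemma sinh_ge0 (t : R) : 0 <= t -> 0 <= sinh t.
Proof.
by move=> t0; rewrite divr_ge0 // subr_ge0 ler_expR; lra.
Qed.

Lemma cosh_gt_sinh (K : R) : 0 <= K ->
  exists2 eps : R, 0 < eps & forall t, 0 <= t <= eps ->
    forall k, `|k| <= K -> 0 < cosh t + k * sinh t.
Proof.
move=> K0; have K1 : 0 < K + 1 by lra.
have K2 : 1 < (K + 2) / (K + 1) by rewrite ltr_pdivlMr //; lra.
(* The inequality [(K + 1) * sinh t < cosh t] amounts to [K * expR (2 * t) < K + 2]. Bounding
   [expR (2 * t)] by [(K + 2) / (K + 1)] suffices and also covers [K = 0]. *)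
exists (ln ((K + 2) / (K + 1)) / 2); first by rewrite divr_gt0 // ln_gt0.
move=> t /andP[t0 tK] k /ler_normlP[kK _].
have s0 := sinh_ge0 t0.
have : expR t * expR t <= (K + 2) / (K + 1).
  rewrite -expRD -[leRHS]lnK ?posrE; last by lra.
  by rewrite ler_expR; lra.
rewrite ler_pdivlMr // => h.
have e1 := expRxMexpNx_1 t; have p := expR_gt0 t; have p' := expR_gt0 (- t).
have {}h : 0 < cosh t - (K + 1) * sinh t.
  rewrite /cosh /sinh; nra.
nra.
Qed.

End Hyperbolic.

(** * The hyperbolic family on a single face *)

Section HyperbolicQuad.
Context {R : realType} {d : nat}.

Definition comb_quad (x y : R) (q q' : quad R d) : quad R d :=
  Quad (x *: qA q + y *: qA q') (x *: qB q + y *: qB q')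
       (x *: qC q + y *: qC q') (x *: qD q + y *: qD q').

(* Each side of the combination is the corresponding side of [q] scaled by
   [cosh t + k * sinh t], where [k] is the factor of that side in the dual. *)
Lemma hyperbolic_quad (q q' : quad R d) :
  convex_quad q -> dual_quads q q' -> quad_area q = quad_area q' ->
  exists2 eps : R, 0 < eps & forall t, 0 <= t <= eps ->
    let qt := comb_quad (cosh t) (sinh t) q q' in
    [/\ convex_quad qt, parallel_sides q qt & quad_area q = quad_area qt].
Proof.
move=> /convex_quad_diag[Q [u [v [a [b [c [e [uv [a0 b0 c0 e0] ->]]]]]]]].
move=> /dual_quads_edges-/(_ uv a0 b0 c0 e0)[mu dq].
rewrite (dual_same_area Q uv _ _ _ _ dq) // => mu2.
have [a1 b1 c1 e1] : [/\ a != 0, b != 0, c != 0 & e != 0] by rewrite !gt_eqF.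
set k1 := - (mu / (a * b)); set k2 := mu / (b * c).
set k3 := - (mu / (c * e)); set k4 := mu / (e * a).
(* The sum of the absolute values bounds all four side factors at once. *)
have [|eps eps0 pos] := @cosh_gt_sinh R (`|k1| + `|k2| + `|k3| + `|k4|).
  by rewrite !addr_ge0.
exists eps => // t /pos{}pos.
have n1 := normr_ge0 k1; have n2 := normr_ge0 k2.
have n3 := normr_ge0 k3; have n4 := normr_ge0 k4.
set x1 := cosh t + k1 * sinh t; set x2 := cosh t + k2 * sinh t.
set x3 := cosh t + k3 * sinh t; set x4 := cosh t + k4 * sinh t.
have p1 : 0 < x1 by apply: pos; lra.
have p2 : 0 < x2 by apply: pos; lra.
have p3 : 0 < x3 by apply: pos; lra.
have p4 : 0 < x4 by apply: pos; lra.
case: q' dq => A' B' C' D' [d1 d2 d3 d4].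
have comb (X Y X' Y' : 'rV[R]_d) : cosh t *: Y + sinh t *: Y' -
    (cosh t *: X + sinh t *: X') = cosh t *: (Y - X) + sinh t *: (Y' - X').
  by apply/rowP => k; rewrite !mxE; ring.
rewrite /comb_quad /=.
set At := cosh t *: _ + sinh t *: A'; set Bt := cosh t *: _ + sinh t *: B'.
set Ct := cosh t *: _ + sinh t *: C'; set Dt := cosh t *: _ + sinh t *: D'.
have f1 : Bt - At = (x1 * a) *: u + (- (x1 * b)) *: v.
  by rewrite comb d1; apply/rowP => k;
    rewrite !mxE /x1 /k1; field; rewrite a1 b1.
have f2 : Ct - Bt = (x2 * c) *: u + (x2 * b) *: v.
  by rewrite comb d2; apply/rowP => k;
    rewrite !mxE /x2 /k2; field; rewrite b1 c1.
have f3 : Dt - Ct = (- (x3 * c)) *: u + (x3 * e) *: v.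
  by rewrite comb d3; apply/rowP => k;
    rewrite !mxE /x3 /k3; field; rewrite c1 e1.
have f4 : At - Dt = (- (x4 * a)) *: u + (- (x4 * e)) *: v.
  by rewrite comb d4; apply/rowP => k;
    rewrite !mxE /x4 /k4; field; rewrite e1 a1.
have ac := addr_gt0 a0 c0; have be := addr_gt0 b0 e0.
have r12 : x1 * a * (x2 * b) - - (x1 * b) * (x2 * c) = x1 * x2 * (b * (a + c)).
  by ring.
have r23 : x2 * c * (x3 * e) - x2 * b * - (x3 * c) = x2 * x3 * (c * (b + e)).
  by ring.
have r34 : - (x3 * c) * - (x4 * e) - x3 * e * - (x4 * a) =
    x3 * x4 * (e * (a + c)) by ring.
have r41 : - (x4 * a) * - (x1 * b) - - (x4 * e) * (x1 * a) =
    x4 * x1 * (a * (b + e)) by ring.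
split.
- by apply: (convex_quad_coord uv f1 f2 f3 f4);
    rewrite ?r12 ?r23 ?r34 ?r41 !mulr_gt0.
- split.
  + exists x1; first by rewrite gt_eqF.
    by rewrite f1; apply/rowP => k; rewrite !mxE; ring.
  + exists x2; first by rewrite gt_eqF.
    by rewrite f2; apply/rowP => k; rewrite !mxE; ring.
  + exists x3; first by rewrite gt_eqF.
    by rewrite f3; apply/rowP => k; rewrite !mxE; ring.
  + exists x4; first by rewrite gt_eqF.
    by rewrite f4; apply/rowP => k; rewrite !mxE; ring.
suff: quad_area (diag_quad Q u v a b c e) = quad_area (Quad At Bt Ct Dt) by [].
rewrite quad_area_diag // (quad_area_coord f1 f2 f3 f4) r12 r34.
rewrite !gtr0_norm ?mulr_gt0 //; congr (_ * _).
(* The mixed terms in [cosh t * sinh t] from the triangles [ABC] and [CDA] cancel, because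
   [b * (k1 + k2) + e * (k3 + k4) = 0]. *)
transitivity ((a + c) * (b + e) *
    (cosh t ^+ 2 - mu ^+ 2 / (a * b * c * e) * sinh t ^+ 2)).
  by rewrite mu2 divff ?mul1r ?cosh_sinh_sqr ?mulr1 // gt_eqF // !mulr_gt0.
by rewrite /x1 /x2 /x3 /x4 /k1 /k2 /k3 /k4; field; rewrite a1 b1 c1 e1.
Qed.

End HyperbolicQuad.

(** * Integration of edge vectors over a grid and a common bound on [t] *)

Section Nets.
Context {R : realType}.

(** A discrete closed form is exact: [S i j] sums [h] along row 0 and then [v] up column [i]. *)
Lemma net_of_edges (V : zmodType) (m n : nat) (h v : nat -> nat -> V) :
  (forall i j, (i < m)%N -> (j < n)%N ->
     h i j + v i.+1 j = v i j + h i j.+1) ->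
  exists S : nat -> nat -> V,
    (forall i j, (i < m)%N -> (j <= n)%N -> S i.+1 j - S i j = h i j) /\
    (forall i j, S i j.+1 - S i j = v i j).
Proof.
move=> closed.
pose S i j := \sum_(0 <= k < i) h k 0 + \sum_(0 <= k < j) v i k.
have Sv i j : S i j.+1 - S i j = v i j.
  by rewrite /S big_nat_recr //= addrA [X in X - _]addrC addrK.
exists S; split=> // i j im; elim: j => [|j IHj] jn.
  by rewrite /S ![\sum_(0 <= k < 0) _]big_geq // !addr0
    big_nat_recr //= [X in X - _]addrC addrK.
(* Closedness of the cell [(i, j)] carries the horizontal increment from row [j] to row [j.+1]. *)
apply: (addrI (v i j)); rewrite -closed // -{1}(Sv i j) -(IHj (ltnW jn)).
rewrite -(Sv i.+1 j) addrC addrA subrK.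
by rewrite [RHS]addrC addrA subrK.
Qed.

Lemma uniform_eps (n : nat) (p : nat -> R -> Prop) :
  (forall i, (i < n)%N ->
     exists2 eps : R, 0 < eps & forall t, 0 <= t <= eps -> p i t) ->
  exists2 eps : R, 0 < eps &
    forall t, 0 <= t <= eps -> forall i, (i < n)%N -> p i t.
Proof.
elim: n => [|n IHn] pn; first by exists 1.
have [i /ltnW/pn //|e e0 he] := IHn.
have [//|f f0 hf] := pn n.
exists (Num.min e f); first by rewrite lt_min e0.
move=> t; rewrite le_min => /and3P[t0 te tf] i.
by rewrite ltnS leq_eqVlt => /predU1P[->|/he]; [apply: hf|apply]; rewrite t0.
Qed.

End Nets.

(** * From single faces to nets *)

Section ChristoffelDual.
Context {R : realType} {m n d : nat}.
Implicit Types P Ps : points R m n d.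

Lemma eq_of_mul_eq (x y r1 r2 : R) :
  x != 0 -> y * r1 = x -> y * r2 = x -> r1 = r2.
Proof.
move=> x0 e1 e2; have y0 : y != 0.
  by apply: contra_neq x0 => y0; rewrite -e1 y0 mul0r.
by apply: (mulfI y0); rewrite e1 e2.
Qed.

Lemma equal_ratios_of_dual P Ps :
  christoffel_dual P Ps -> same_face_areas P Ps -> equal_opposite_ratios P.
Proof.
move=> [netP _ dual] area; split=> i j im jn.
- have im' := ltnW im.
  have [_ e1 _ _] := dual_edge_ratios (netP _ _ im' jn) (dual _ _ im' jn)
    (area _ _ im' jn).
  have [_ _ _ e2] := dual_edge_ratios (netP _ _ im jn) (dual _ _ im jn)
    (area _ _ im jn).
  (* The two faces traverse their common edge in opposite directions. *)
  rewrite dot_subC [RHS]dot_subC in e2.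
  apply: eq_of_mul_eq e1 e2.
  have [_ [/free_neq0/dot_gt0 /lt0r_neq0 //]] := netP _ _ im' jn.
- have jn' := ltnW jn.
  have [_ _ e1 _] := dual_edge_ratios (netP _ _ im jn') (dual _ _ im jn')
    (area _ _ im jn').
  have [e2 _ _ _] := dual_edge_ratios (netP _ _ im jn) (dual _ _ im jn)
    (area _ _ im jn).
  rewrite dot_subC [RHS]dot_subC in e2.
  apply: eq_of_mul_eq e1 e2.
  have [_ _ [/free_neq0/dot_gt0 /lt0r_neq0 //]] := netP _ _ im jn'.
Qed.

Lemma dual_of_equal_ratios P : is_net P -> equal_opposite_ratios P ->
  exists Ps, christoffel_dual P Ps /\ same_face_areas P Ps.
Proof.
move=> netP [ratio1 ratio2].
pose p i j := P (inord i) (inord j).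
pose F (f : 'rV[R]_d -> 'rV[R]_d -> 'rV[R]_d -> 'rV[R]_d -> R) i j :=
  f (p i j) (p i.+1 j) (p i.+1 j.+1) (p i j.+1).
pose F1 := F dual_factor.
pose F2 := F (fun A B C D => dual_factor B C D A).
pose F3 := F (fun A B C D => dual_factor C D A B).
pose F4 := F (fun A B C D => dual_factor D A B C).
(* Each edge takes its factor from the face with the smaller index, so the last row and column are
   covered; only edges with index 0 use the face after them. *)
pose hfac i j := if j is j'.+1 then F3 i j' else F1 i 0%N.
pose vfac i j := if i is i'.+1 then F2 i' j else F4 0%N j.
(* Equality of opposite ratios enters here: the face on the other side of the edge prescribes the
   same factor. *)
have hfacE i j : (i < m)%N -> (j < n)%N -> hfac i j = F1 i j.
  case: j => // j im jn; rewrite /= /F3 /F1 /F /dual_factor.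
  by rewrite (ratio2 _ _ im jn).
have vfacE i j : (i < m)%N -> (j < n)%N -> vfac i j = F4 i j.
  case: i => // i im jn; rewrite /= /F2 /F4 /F /dual_factor.
  by rewrite (ratio1 _ _ im jn).
(* The minus sign on the horizontal edges realizes the alternation of signs around every face. *)
have [|S [Sh Sv]] := @net_of_edges 'rV[R]_d m n
    (fun i j => - hfac i j *: (p i.+1 j - p i j))
    (fun i j => vfac i j *: (p i j.+1 - p i j)).
  move=> i j im jn; rewrite hfacE // (vfacE i j) //.
  exact: dual_factors_closed (netP _ _ im jn).
pose Ps : points R m n d := fun i j => S i j; exists Ps.
have faceS i j : (i < m)%N -> (j < n)%N -> face Ps i j =
    Quad (S i j) (S i.+1 j) (S i.+1 j.+1) (S i j.+1).
  by move=> im jn; rewrite /face /Ps !inordK // ltnS ltnW.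
have dualS i j : (i < m)%N -> (j < n)%N ->
    let q := face P i j in let q' := face Ps i j in
    [/\ convex_quad q', dual_quads q q' & quad_area q = quad_area q'].
  move=> im jn; rewrite faceS //.
  apply: dual_quad_of_factors (netP _ _ im jn) _ _ _ _.
  - by rewrite Sh ?hfacE // ltnW.
  - by rewrite Sv.
  - by rewrite Sh.
  - by rewrite Sv vfacE.
by split; [split=> //|]; move=> i j im jn; have [] := dualS i j im jn.
Qed.

Lemma hyperbolic_family_combescure P Ps :
  christoffel_dual P Ps -> same_face_areas P Ps ->
  exists2 eps : R, 0 < eps &
    forall t : R, 0 <= t <= eps ->
      area_preserving_combescure P (hyperbolic_family P Ps t).
Proof.
move=> [netP _ dual] area.
pose good i j t := [/\ convex_quad (face (hyperbolic_family P Ps t) i j),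
  parallel_sides (face P i j) (face (hyperbolic_family P Ps t) i j) &
  quad_area (face P i j) = quad_area (face (hyperbolic_family P Ps t) i j)].
have [eps eps0 h] : exists2 eps : R, 0 < eps & forall t, 0 <= t <= eps ->
    forall i, (i < m)%N -> forall j, (j < n)%N -> good i j t.
  (* There are finitely many faces, so a minimum over each index gives one bound for all of them. *)
  apply: uniform_eps => i im; apply: uniform_eps => j jn.
  exact: hyperbolic_quad (netP _ _ im jn) (dual _ _ im jn) (area _ _ im jn).
exists eps => // t /h{}h.
by split; [split=> //|]; move=> i j im jn; have [] := h i im j jn.
Qed.

End ChristoffelDual.

Theorem proposition3p6 (R : realType) (m n d : nat) (P : points R m n d)
    (hP : is_net P) :
  (equal_opposite_ratios P <->
   exists Ps : points R m n d, christoffel_dual P Ps /\ same_face_areas P Ps) /\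
  (forall Ps : points R m n d,
     christoffel_dual P Ps -> same_face_areas P Ps ->
     exists2 eps : R, 0 < eps &
       forall t : R, 0 <= t <= eps ->
         area_preserving_combescure P (hyperbolic_family P Ps t)).
Proof.
split; last by move=> Ps; apply: hyperbolic_family_combescure.
split; first exact: dual_of_equal_ratios.
by case=> Ps [dual area]; apply: equal_ratios_of_dual dual area.
Qed.
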